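(* Let $n=2m\geq 4$ for some integer $m$, let $t>1$ be a proper divisor of $n$, and let $0\leq s\leq t-1$. Let $G=D_{2n}=\langle a,b : a^n=b^2=e,\ b^{-1}ab=a^{-1}\rangle$ and let $H=\langle a^t,a^sb\rangle$. Let $(\alpha,\beta)\neq(0,0)$ be a pair of non-negative integers. Then $H$ is an $(\alpha,\beta)$-regular set of $G$ if and only if one of the following occurs (with $\eta,\zeta,\gamma$ denoting integers): (1) $t=2$, $m$ is odd, $\alpha\in\{0,|H|/2\}$ and $0\leq\beta\leq|H|$; (2) $t=2$, $m$ is even, $\alpha\in\{0,|H|/2\}$ and $0\leq\beta=2\gamma\leq|H|$ for some integer $\gamma$; (3) $t>2$ is even and $(\alpha,\beta)=(|H|/2,|H|/2)$; (4) $m$ is odd, $t$ is a divisor of $m$, and $(\alpha,\beta)\in\{(\eta,\zeta),\ (\eta+m/t,\zeta+m/t),\ (\eta+2m/t,\zeta+2m/t) : 0\leq\eta,\zeta\leq m/t\}$; (5) $m$ is even, $t$ is odd, and $(\alpha,\beta)\in\{(2\eta,\zeta),\ (2\eta+m/t,\zeta+m/t),\ (2\eta+2m/t,\zeta+2m/t) : 0\leq\eta\leq m/(2t),\ 0\leq\zeta\leq m/t\}$.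
   Context: $D_{2n}$ is the dihedral group of order $2n$. An element $x$ of a group $G$ is a square if $x=y^2$ for some $y\in G$. A subset of $G$ is square-free if none of its elements is a square of $G$; a subset $S$ is normal if $g^{-1}Sg=S$ for all $g\in G$. For a normal square-free subset $S$ of $G$ (possibly empty), the Cayley sum graph $\mathrm{CayS}(G,S)$ is the simple graph with vertex set $G$ in which $x,y$ are adjacent if and only if $xy\in S$. A set $C$ of vertices of a graph is an $(\alpha,\beta)$-regular set in the graph if every vertex in $C$ is adjacent to exactly $\alpha$ vertices of $C$ and every vertex not in $C$ is adjacent to exactly $\beta$ vertices of $C$. A subset $C\subseteq G$ is an $(\alpha,\beta)$-regular set of $G$ if it is an $(\alpha,\beta)$-regular set in $\mathrm{CayS}(G,S)$ for some normal square-free subset $S$ of $G$. *)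

(* Defs.v *)
From mathcomp Require Import all_boot all_fingroup all_solvable.

Set Implicit Arguments.
Unset Strict Implicit.
Unset Printing Implicit Defensive.

Local Open Scope group_scope.

(* Groups are subgroups G of an ambient finGroupType: square roots and        *)
(* conjugating elements are taken in G, not in the ambient type.              *)

Definition is_square (gT : finGroupType) (G : {set gT}) (x : gT) : Prop :=
  exists2 y, y \in G & x = y ^+ 2.

Definition square_free (gT : finGroupType) (G S : {set gT}) : Prop :=
  forall x, x \in S -> ~ is_square G x.

Definition normal_subset (gT : finGroupType) (G S : {set gT}) : Prop :=
  S \subset G /\ {in G, normalised S}.

Definition CayS (gT : finGroupType) (S : {set gT}) : rel gT :=
  fun x y => x * y \in S.

(* The next two lemmas show that CayS S is a simple graph on the vertex set G *)
(* when S is a normal square-free subset of G.                                *)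

Lemma CayS_sym (gT : finGroupType) (G : {group gT}) (S : {set gT}) :
  normal_subset G S -> {in G &, symmetric (CayS S)}.
Proof.
move=> [_ nSG] x y Gx Gy; rewrite /CayS.
by rewrite -{1}(nSG y Gy) mem_conjg conjgE invgK mulgK.
Qed.

Lemma CayS_irr (gT : finGroupType) (G : {group gT}) (S : {set gT}) :
  square_free G S -> {in G, irreflexive (CayS S)}.
Proof.
move=> sfS x Gx; apply/negP => Sxx; apply: (sfS _ Sxx).
by exists x.
Qed.

Definition regular_set_in_graph (T : finType) (V : {set T})
    (e : rel T) (C : {set T}) (alpha beta : nat) : Prop :=
  [/\ C \subset V,
      forall x, x \in C -> #|[set y in C | e x y]| = alpha
    & forall x, x \in V :\: C -> #|[set y in C | e x y]| = beta].

Definition regular_set (gT : finGroupType) (G C : {set gT})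
    (alpha beta : nat) : Prop :=
  exists S : {set gT},
    [/\ normal_subset G S, square_free G S
      & regular_set_in_graph G (CayS S) C alpha beta].

(* Main.v *)
(* The cosets of H partition G, and the neighbours of x in H correspond to     *)
(* the points of S in xH; so H is (alpha, beta)-regular iff S has alpha points *)
(* in H and beta points in every coset a^i H with 0 < i < t. The squares of G  *)
(* are the even rotations, and conjugation inverts rotations and fuses the     *)
(* reflections a^k b with k of the same parity: S is an inversion-closed set   *)
(* of odd rotations together with any of the two classes of reflections. If t  *)
(* is even, the parity of exponents is constant on each half of a coset, and   *)
(* all counts are forced except for the number of odd rotations when t = 2.    *)
(* If t is odd, each class of reflections adds m/t to every count, while the   *)
(* m/t odd rotations of a^i H can be chosen freely for 0 < i < t/2, inversion  *)
(* swapping a^i H and a^(t-i) H. Those of H itself are permuted by inversion,  *)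
(* with a fixed point iff m is odd; the same happens for the odd rotations     *)
(* when t = 2. This is the only source of parity constraints.                  *)

Require Import Defs.
From mathcomp Require Import all_boot all_fingroup all_solvable.
From mathcomp Require Import zify.

Set Implicit Arguments.
Unset Strict Implicit.
Unset Printing Implicit Defensive.

(** [regular_dihedral_subP] removes the group: membership in S is recorded by a rotation pattern [P]
    and a choice [q] of reflection classes, and conversely every such pair comes from a normal
    square-free S. What remains is which values [coset_count] can take, settled for t = 2, t > 2
    even and t odd by [realizable_counts_two], [realizable_counts_even] and [realizable_counts_odd].
    On a coset stable under inversion, inversion reverses the list of odd rotations, so S picks a
    palindromic 0/1 sequence. Its sum is arbitrary if the length is odd and any even number if the
    length is even ([palindrome_sum_even], [palindrome_sum_exists]). For t odd, the three families
    of (4) and (5) correspond to S containing 0, 1 or 2 classes of reflections. *)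

(* P k stands for a^k \in S, and below q (odd k) for a^k b \in S.             *)
Definition rotation_pattern (n : nat) (P : pred nat) : Prop :=
  [/\ forall k, P (k %% n) = P k, forall k, k <= n -> P (n - k) = P k
    & forall k, ~~ odd k -> P k = false].

(** The number of points of S in a^i H, whose elements are the rotations a^(i + tk) and the
    reflections a^(i + s + tk) b. *)
Definition coset_count (n t s : nat) (P : pred nat) (q : pred bool) (i : nat) :=
  \sum_(k < n %/ t) (P (i + t * k) : nat)
  + \sum_(k < n %/ t) (q (odd (i + s + t * k)) : nat).

Definition realizable_counts (n t s alpha beta : nat) : Prop :=
  exists (P : pred nat) (q : pred bool),
    [/\ rotation_pattern n P, coset_count n t s P q 0 = alpha
      & forall i, 0 < i < t -> coset_count n t s P q i = beta].

(** * Sums of palindromic sequences *)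

Lemma sum_double (F : nat -> nat) r :
  \sum_(k < 2 * r) F k = \sum_(p < r) (F (2 * p) + F (2 * p).+1).
Proof.
elim: r => [|r IHr]; first by rewrite muln0 !big_ord0.
by rewrite [RHS]big_ord_recr /= -IHr mulnS !big_ord_recr /= addnA.
Qed.

(** Positions j and k - 1 - j pair off without a middle one; the induction strips both ends. *)
Lemma palindrome_sum_even (F : nat -> nat) k :
    ~~ odd k -> (forall j, j < k -> F (k.-1 - j) = F j) ->
  ~~ odd (\sum_(j < k) F j).
Proof.
move=> ev_k; rewrite -(even_halfK ev_k).
elim: k./2 F => [|h IHh] F symF; first by rewrite big_ord0.
rewrite doubleS big_ord_recl big_ord_recr /= /bump /=.
have -> : F (1 + h.*2) = F 0 by exact: (symF 0 isT).
have := IHh (fun j => F j.+1); rewrite addnCA addnn oddD odd_double addbF.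
apply=> j ltj; rewrite -[RHS]symF; last by lia.
by congr F; lia.
Qed.

Lemma palindrome_sum_exists k v :
    v <= k -> odd k || ~~ odd v ->
  exists2 F : pred nat, forall j, j < k -> F (k.-1 - j) = F j
    & \sum_(j < k) (F j : nat) = v.
Proof.
have [h] := ubnP k; elim: h => // h IHh in k v *.
case: k => [|[|k]].
- by rewrite leqn0 => _ /eqP-> _; exists xpred0; rewrite ?big_ord0.
- move=> _ lev _; exists (fun _ => v == 1) => //.
  by rewrite big_ord1; case: v lev => [|[]].
move=> lekh lev odd_kv.
(* [c] fills both end positions as soon as v is at least 2; [w] is left for the k inner ones. *)
pose c := 1 < v; pose w := v - c.*2.
have lewk : w <= k by rewrite /w /c; lia.
have [|||F symF sumF] := IHh k w; [by lia | by [] | by rewrite /w /c; lia |].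
exists (fun j => if (j == 0) || (j == k.+1) then c else F j.-1) => [j ltj|].
  case: j => [|j] in ltj *; first by rewrite subn0 /= eqxx.
  rewrite /= subSS eqSS subn_eq0.
  have [-> | ne_jk] := eqVneq j k; first by rewrite leqnn.
  have lt_jk : j < k by lia.
  rewrite leqNgt lt_jk /= (_ : (k - j == k.+1) = false); last by lia.
  by rewrite -(symF _ lt_jk); congr (F _); lia.
rewrite big_ord_recl big_ord_recr /= /bump /= eqxx.
under eq_bigr => j _ do rewrite eqSS (ltn_eqF (ltn_ord j)).
by rewrite sumF /w /c; lia.
Qed.

Lemma sum_ltn r y : y <= r -> \sum_(p < r) (p < y : nat) = y.
Proof.
move=> le_yr; rewrite -big_mkcond /= (big_ord_narrow le_yr) /=.
by rewrite sum_nat_const card_ord muln1.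
Qed.

Lemma sum_rev_ltn r y : y <= r -> \sum_(p < r) (r.-1 - p < y : nat) = y.
Proof.
move=> le_yr; rewrite (reindex_inj rev_ord_inj) -[RHS](sum_ltn le_yr).
by apply: eq_bigr => p _ /=; congr (_ < _ : nat); have := ltn_ord p; lia.
Qed.

(** * Which pairs of coset counts are realizable *)

Lemma coset_count_even n t s P q i :
    ~~ odd t ->
  coset_count n t s P q i
    = \sum_(k < n %/ t) (P (i + t * k) : nat) + n %/ t * q (odd (i + s)).
Proof.
move=> ev_t; congr (_ + _).
under eq_bigr => k _ do rewrite oddD oddM (negbTE ev_t) addbF.
by rewrite sum_nat_const card_ord.
Qed.

(** For t odd, the exponents i + tk alternate in parity. Each pair k = 2p, 2p + 1 thus gives one odd
    rotation, at k = 2p + [~~ odd i], and one reflection of each class. *)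
Lemma coset_count_odd m t s P q i :
    rotation_pattern (2 * m) P -> odd t -> t %| m ->
  coset_count (2 * m) t s P q i
    = \sum_(p < m %/ t) (P (i + t * (2 * p + ~~ odd i)) : nat)
      + m %/ t * (q false + q true).
Proof.
move=> [_ _ Peven] odd_t tm; rewrite /coset_count -muln_divA //.
rewrite (sum_double (fun k => P (i + t * k) : nat)).
rewrite (sum_double (fun k => q (odd (i + s + t * k)) : nat)).
congr (_ + _).
  apply: eq_bigr => p _; case odd_i: (odd i); rewrite /= ?addn0 ?addn1.
    rewrite (Peven (i + t * (2 * p).+1)) ?addn0 //.
    by rewrite oddD oddM odd_t /= oddM odd_i.
  by rewrite Peven // oddD oddM odd_t /= oddM odd_i.
rewrite -[m %/ t in RHS]card_ord -sum_nat_const; apply: eq_bigr => p _.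
rewrite !oddD !oddM /= odd_t !oddM /=.
by case: (odd i (+) odd s); rewrite //= addnC.
Qed.

(** H has only even rotations and one class of reflections; aH has all m odd rotations and the other
    class. *)
Lemma realizable_counts_two m s alpha beta :
    0 < m ->
  realizable_counts (2 * m) 2 s alpha beta <->
  [/\ alpha = 0 \/ alpha = m, beta <= 2 * m & odd m || ~~ odd beta].
Proof.
move=> m_gt0; have dm : 2 * m %/ 2 = m by rewrite mulKn.
split=> [[P [q [[Pmod PN Peven] <- cntO]]] | [alphaE le_beta odd_mb]].
  rewrite -(cntO 1) // !coset_count_even // dm big1 => [|k _]; last first.
    by rewrite Peven // add0n oddM.
  have le_sum : \sum_(k < m) (P (1 + 2 * k) : nat) <= m.
    rewrite -[X in _ <= X]card_ord -[#|_|]muln1 -sum_nat_const.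
    by apply: leq_sum => k _; case: (P _).
  split.
  - by rewrite add0n; case: (q _); rewrite ?muln1 ?muln0; [right | left].
  - by case: (q _); lia.
  case: (boolP (odd m)) => //= ev_m.
  rewrite oddD oddM (negbTE ev_m) addbF.
  apply: (palindrome_sum_even ev_m (F := fun k => P (1 + 2 * k) : nat)) => j ltj.
  by rewrite -[in RHS]PN; [congr (P _ : nat); lia | lia].
(* [e] tells whether the m reflections of aH are taken; [v] odd rotations make up the rest. *)
pose e := m < beta; pose v := beta - e * m.
have [||F symF sumF] := @palindrome_sum_exists m v.
- by rewrite /v /e; case: ltnP; lia.
- rewrite /v /e; case: (boolP (odd m)) odd_mb => //= ev_m ev_b.
  case: ltnP => lt_mb; last by rewrite mul0n subn0.
  by rewrite mul1n (oddB (ltnW lt_mb)) (negbTE ev_m) addbF.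
pose P k := odd k && F ((k %% (2 * m))./2).
pose q d := if d == odd s then alpha == m else e.
have odd_mod2m k : odd (k %% (2 * m)) = odd k by rewrite odd_mod // oddM.
exists P, q; split=> [||i i1].
- split=> k; rewrite /P ?odd_mod2m ?modn_mod //; last by move/negbTE->.
  move=> le_k.
  rewrite oddB // oddM /=; case: (boolP (odd k)) => //= odd_k.
  rewrite !modn_small; [|lia|lia].
  rewrite -[in RHS]symF; last by lia.
  by congr (F _); lia.
- rewrite coset_count_even // dm big1 => [|k _]; last by rewrite /P oddM.
  rewrite !add0n /q eqxx; case: alphaE => ->; rewrite ?eqxx ?muln1 //.
  by rewrite eq_sym (gtn_eqF m_gt0) muln0.
have -> : i = 1 by lia.
rewrite coset_count_even // dm /q /=.
rewrite (_ : (~~ odd s == odd s) = false); last by case: (odd s).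
have -> : \sum_(k < m) (P (1 + 2 * k) : nat) = v.
  rewrite -sumF; apply: eq_bigr => k _.
  rewrite /P oddD oddM /= modn_small; last by have := ltn_ord k; lia.
  by congr (F _ : nat); lia.
by rewrite /v /e; case: ltnP => /=; lia.
Qed.

Lemma realizable_counts_even m t s alpha beta :
    2 < t -> ~~ odd t ->
  realizable_counts (2 * m) t s alpha beta <->
  (alpha, beta) = (0, 0) \/ (alpha, beta) = ((2 * m) %/ t, (2 * m) %/ t).
Proof.
move=> t_gt2 ev_t; split=> [[P [q [[Pmod PN Peven] <- cntO]]] | ab].
  (* Since t > 2, a^2 H differs from H, yet it also has only even rotations and the same class of
     reflections, so the two counts agree. *)
  rewrite -(cntO 2) // !coset_count_even //= negbK.
  rewrite !big1 => [|k _|k _]; try by rewrite Peven // oddD oddM (negbTE ev_t).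
  by case: (q _); rewrite ?muln1 ?muln0; [right | left].
pose c := (alpha != 0).
exists xpred0, (fun=> c).
have cnt i : coset_count (2 * m) t s xpred0 (fun=> c) i = alpha.
  rewrite coset_count_even // big1 // add0n /c.
  case: ab => [[-> _]|[-> _]]; first by rewrite eqxx muln0.
  by case: eqP => [->|_]; rewrite ?muln0 ?muln1.
split=> [||i _] //; rewrite cnt.
by case: ab => [[-> ->]|[-> ->]].
Qed.

Lemma muln_mirror m r t j :
    m = r * t -> j < r ->
  2 * m - t * (2 * j + 1) = t * (2 * (r.-1 - j) + 1).
Proof.
move=> -> lt_jr; have [d ->] : exists d, r = j + d.+1 by exists (r - j.+1); lia.
by rewrite (_ : (j + d.+1).-1 - j = d); lia.
Qed.

(** Inversion in the coordinates (k mod t, half of k / t) of an odd exponent k: the first is negated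
    mod t, the second reversed. If t divides k, the quotient is odd and becomes 2r - l; otherwise it
    becomes 2r - l - 1; both have the same half. *)
Lemma mirror_divn r t k :
    odd t -> odd k -> k < 2 * r * t ->
  [/\ (k %/ t)./2 < r,
      ((2 * r * t - k) %/ t)./2 = r.-1 - (k %/ t)./2
    & (2 * r * t - k) %% t = (t - k %% t) %% t].
Proof.
move=> odd_t odd_k lt_k; have t_gt0 := odd_gt0 odd_t.
have lt_l : k %/ t < 2 * r by rewrite ltn_divLR.
have lt_i := ltn_pmod k t_gt0; move: (divn_eq k t) odd_k {lt_k}.
move: (k %/ t) (k %% t) lt_l lt_i => l i lt_l lt_i -> {k} odd_k.
split; first by clear -lt_l; lia.
  have [i0 | i_neq0] := eqVneq i 0.
    have odd_l : odd l by move: odd_k; rewrite i0 addn0 oddM => /andP[].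
    by rewrite i0 addn0 -mulnBl mulnK //; clear -lt_l odd_l; lia.
  rewrite subnDA -mulnBl -(@subnK 1 (2 * r - l)) ?subn_gt0 //.
  rewrite mulnDl mul1n -addnBA ?(ltnW lt_i) // divnMDl //.
  rewrite (@divn_small (t - i)) ?ltn_subrL ?t_gt0 ?lt0n ?i_neq0 //.
  by clear -lt_l; lia.
rewrite subnDA -mulnBl -(@subnK 1 (2 * r - l)) ?subn_gt0 //.
by rewrite mulnDl mul1n -addnBA ?(ltnW lt_i) // modnMDl.
Qed.

(** [e] counts the classes of reflections in S, [x] the odd rotations of S in H and [y] those in any
    other coset. Only [x] is constrained, H being stable under inversion. *)
Lemma realizable_counts_odd m t s alpha beta :
    0 < m -> 1 < t -> odd t -> t %| m ->
  realizable_counts (2 * m) t s alpha beta <->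
  exists e x y, [/\ e <= 2, x <= m %/ t, y <= m %/ t, odd m || ~~ odd x
    & (alpha, beta) = (x + m %/ t * e, y + m %/ t * e)].
Proof.
move=> m_gt0 t_gt1 odd_t tm; pose r := m %/ t.
have mE : m = r * t by rewrite divnK.
have odd_m : odd m = odd r by rewrite mE oddM odd_t andbT.
split=> [[P [q [patP <- cntO]]] | [e [x [y [le_e le_x le_y odd_mx [-> ->]]]]]].
  have le_sum i : \sum_(p < r) (P (i + t * (2 * p + ~~ odd i)) : nat) <= r.
    rewrite -[X in _ <= X]card_ord -[#|_|]muln1 -sum_nat_const.
    by apply: leq_sum => k _; case: (P _).
  exists (q false + q true), (\sum_(p < r) (P (0 + t * (2 * p + 1)) : nat)).
  exists (\sum_(p < r) (P (1 + t * (2 * p + 0)) : nat)).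
  split; [by case: (q false) (q true) => [] [] | exact: le_sum 0
         | exact: le_sum 1 | | by rewrite -(cntO 1) // !coset_count_odd].
  rewrite odd_m; case: (boolP (odd r)) => //= ev_r; case: patP => _ PN _.
  apply: (palindrome_sum_even ev_r
    (F := fun p => P (0 + t * (2 * p + 1)) : nat)) => j ltj.
  rewrite !add0n -(muln_mirror mE ltj) PN // mE mulnA [2 * r]mulnC.
  by rewrite mulnC leq_mul2r; apply/orP; right; lia.
have [//||F symF sumF] := @palindrome_sum_exists r x; first by rewrite -odd_m.
(* W i p decides on the p-th odd rotation of a^i H; inversion maps the index   *)
(* (i, p) to (-i mod t, r.-1 - p).                                             *)
pose W i p := if i == 0 then F p else if 2 * i < t then p < y else r.-1 - p < y.
(* Among the quotients 2p and 2p + 1 exactly one gives an odd exponent, so halving the quotient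
   numbers the odd rotations of a coset. *)
pose P k := odd k && W (k %% t) ((k %% (2 * m)) %/ t)./2.
have odd_mod2m k : odd (k %% (2 * m)) = odd k by rewrite odd_mod // oddM.
have patP : rotation_pattern (2 * m) P.
  split=> k; rewrite /P ?odd_mod2m ?modn_mod.
  - by rewrite modn_dvdm // dvdn_mull.
  - move=> le_k.
    rewrite oddB // oddM /=; case: (boolP (odd k)) => //= odd_k.
    have lt_k : k < 2 * m.
      rewrite ltn_neqAle le_k andbT; apply: contraTneq odd_k => ->.
      by rewrite oddM.
    have lt_nk : 2 * m - k < 2 * m by move: (odd_gt0 odd_k); lia.
    rewrite (modn_small lt_k) (modn_small lt_nk).
    have [] := @mirror_divn r t k; rewrite -?mulnA -?mE // => lt_pr -> ->.
    have t_gt0 : 0 < t := ltnW t_gt1.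
    have := ltn_pmod k t_gt0; rewrite /W; set i := k %% t => lt_it.
    have [-> | i_neq0] := eqVneq i 0; first by rewrite subn0 modnn eqxx symF.
    have lt_ti : t - i < t by rewrite ltn_subrL t_gt0 lt0n i_neq0.
    rewrite modn_small // subn_eq0 leqNgt lt_it /=.
    (* As t is odd, exactly one of i and t - i is below t/2, so the two branches of [W] are
       exchanged. *)
    rewrite (_ : (2 * (t - i) < t) = ~~ (2 * i < t)).
      have le_pr : (k %/ t)./2 <= r.-1 by rewrite -ltnS (ltn_predK lt_pr).
      by case: (2 * i < t); rewrite //= subKn.
    by move: odd_t lt_it; clear; lia.
  - by move/negbTE->.
have sumP i : i < t ->
  \sum_(p < r) (P (i + t * (2 * p + ~~ odd i)) : nat)
    = \sum_(p < r) (W i p : nat).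
  move=> lt_it; apply: eq_bigr => p _; rewrite /P.
  have -> /= : odd (i + t * (2 * p + ~~ odd i)).
    by rewrite oddD oddM odd_t /= oddD oddM /=; case: (odd i).
  rewrite (@modn_small _ (2 * m)); last first.
    have : t * (2 * p + ~~ odd i).+1 <= t * (2 * r).
      by rewrite leq_mul2l; have := ltn_ord p; rewrite -/r; lia.
    by rewrite mulnS mulnCA [t * r]mulnC -mE; lia.
  rewrite addnC mulnC modnMDl divnMDl ?(ltnW t_gt1) //.
  rewrite modn_small // divn_small //.
  by congr (W _ _ : nat); clear; case: (odd i); lia.
exists P, (fun d => if d then e == 2 else 0 < e).
have eE : (0 < e) + (e == 2) = e by case: e le_e => [|[|[]]].
split=> // [|i /andP[i_gt0 lt_it]]; rewrite coset_count_odd // eE -/r.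
  by rewrite (sumP 0) ?(ltnW t_gt1) // /W eqxx sumF.
rewrite sumP // /W (gtn_eqF i_gt0); congr (_ + _).
by case: (2 * i < t); [exact: sum_ltn | exact: sum_rev_ltn].
Qed.

(** * Cyclic groups and involutions inverting a generator *)

Lemma big_cycle (gT : finGroupType) (u : gT) (F : gT -> nat) :
  \sum_(y in <[u]>%g) F y = \sum_(k < #[u]%g) F (u ^+ k)%g.
Proof.
have injX : {in predT &, injective (fun k : 'I_#[u]%g => (u ^+ k)%g)}.
  move=> i j _ _ /eqP; rewrite eq_expg_mod_order !modn_small ?ltn_ord //.
  by move/eqP/val_inj.
rewrite -(big_imset F injX) /=; apply: eq_bigl => y.
apply/idP/imsetP => [/cyclePmin[k ltk ->] | [k _ ->]]; last exact: mem_cycle.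
by exists (Ordinal ltk).
Qed.

Section InvolutionInverting.

Variables (gT : finGroupType) (x c : gT).
Hypotheses (c2 : (c ^+ 2 = 1)%g) (xc : (x ^ c = x^-1)%g).

Lemma conjX_invol k : ((x ^+ k) ^ c = x ^- k)%g.
Proof. by rewrite conjXg xc expgVn. Qed.

Lemma mul_invol_expg k : (c * x ^+ k = x ^- k * c)%g.
Proof.
rewrite -conjX_invol conjgE.
have -> : (c^-1 = c)%g by apply/eqP; rewrite eq_invg_mul -expg2 c2.
by rewrite -!mulgA -[(c * c)%g]expg2 c2 mulg1.
Qed.

(** Serves both for G, with a and b, and for H, with a^t and a^s b. *)
Lemma gen_invol : (<<[set x; c]>> = <[x]> :|: <[x]> :* c)%g.
Proof.
have cE : (<[c]> = [set 1; c])%g.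
  apply/setP=> y; rewrite !inE; apply/cycleP/orP => [[k ->] | [] /eqP ->].
  - rewrite -[k]odd_double_half expgD -mul2n expgM c2 expg1n mulg1.
    by case: (odd k); rewrite ?eqxx; [right | left].
  - by exists 0.
  - by exists 1.
have nxc : (<[c]> \subset 'N(<[x]>))%g.
  by rewrite cycle_subG inE -cycleJ xc cycleV.
transitivity (<[x]> <*> <[c]>)%g; first by rewrite /cycle joing_idl joing_idr.
by rewrite (norm_joinEr nxc) /= cE mulgU mulg1.
Qed.

End InvolutionInverting.

(** * Elements, conjugation and squares in the dihedral group *)

Section Dihedral.

Variables (gT : finGroupType) (G : {group gT}) (a b : gT) (n : nat).
Hypotheses (n_gt0 : 0 < n) (oG : #|G| = 2 * n).
Hypotheses (genG : (<<[set a; b]>> = G)%g) (an : (a ^+ n = 1)%g).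
Hypotheses (b2 : (b ^+ 2 = 1)%g) (ab : (a ^ b = a^-1)%g).

Let GE : (G = <[a]> :|: <[a]> :* b :> {set gT})%g.
Proof. by rewrite -genG gen_invol. Qed.

(** The relations only bound the order of a above; G being covered by two cosets of the cyclic group
    of a, its order 2n gives the other bound. *)
Lemma order_rotation : #[a]%g = n.
Proof.
have le_an : #[a]%g <= n by apply: dvdn_leq => //; rewrite order_dvdn an.
have : #|G| <= #[a]%g + #[a]%g.
  by rewrite GE (leq_trans (leq_card_setU _ _)) // card_rcoset.
by rewrite oG; lia.
Qed.

Lemma reflection_notin_cycle : b \notin <[a]>%g.
Proof.
apply/negP=> ba.
have : #|G| = n by rewrite GE rcoset_id // setUid -order_rotation.
by rewrite oG; lia.
Qed.

Lemma dihedral_eltP x : x \in G ->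
  exists k, x = (a ^+ k)%g \/ x = (a ^+ k * b)%g.
Proof.
rewrite GE inE => /orP[/cycleP[k ->] | /rcosetP[_ /cycleP[k ->] ->]].
  by exists k; left.
by exists k; right.
Qed.

Lemma rotation_in k : (a ^+ k)%g \in G.
Proof. by rewrite GE inE mem_cycle. Qed.

Lemma reflection_in k : (a ^+ k * b)%g \in G.
Proof. by rewrite GE inE mem_rcoset mulgK mem_cycle orbT. Qed.

Lemma eq_rotation i j : (a ^+ i == a ^+ j)%g = (i == j %[mod n]).
Proof. by rewrite eq_expg_mod_order order_rotation. Qed.

Lemma rotation_neq_reflection i j : (a ^+ i == a ^+ j * b)%g = false.
Proof.
apply/negP=> /eqP aij; move: reflection_notin_cycle.
by rewrite -(groupMl b (mem_cycle a j)) -aij mem_cycle.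
Qed.

Lemma rotationV k : k <= n -> (a ^- k = a ^+ (n - k))%g.
Proof.
by move=> le_kn; apply/eqP; rewrite eq_invg_mul -expgD subnKC // an.
Qed.

Lemma reflection_mul i j : ((a ^+ i * b) * (a ^+ j * b) = a ^+ i * a ^- j)%g.
Proof.
by rewrite -mulgA [(b * _)%g]mulgA (mul_invol_expg b2 ab) -(mulgA _ b b)
  -[(b * b)%g]expg2 b2 mulg1.
Qed.

Lemma reflection2 k : ((a ^+ k * b) ^+ 2 = 1)%g.
Proof. by rewrite expg2 reflection_mul mulgV. Qed.

(** Conjugation by a shifts the exponent of a reflection by 2, which fuses reflections of equal
    parity. *)
Lemma reflectionJ_rotation k : ((a ^+ k.+2 * b) ^ a = a ^+ k * b)%g.
Proof.
have ba : (b * a = a^-1 * b)%g := mul_invol_expg b2 ab 1.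
by rewrite conjgE -mulgA ba expgS expgSr !mulgA mulVg mul1g mulgK.
Qed.

Lemma reflectionJ_reflection k : ((a ^+ k * b) ^ b = a ^- k * b)%g.
Proof. by rewrite conjMg (conjX_invol ab) conjgE mulKg. Qed.

Lemma rotation_squareP x :
  is_square G x <-> exists k, x = (a ^+ (2 * k))%g.
Proof.
split=> [[y /dihedral_eltP[k [->|->]] ->] | [k ->]].
- by exists k; rewrite -expgM mulnC.
- by exists 0; rewrite reflection2.
- by exists (a ^+ k)%g; rewrite ?rotation_in // mulnC expgM.
Qed.

(** * The subgroup H, its cosets and neighbour counts *)

Variables (t s : nat).
Hypotheses (tn : t %| n).

Let t_gt0 : 0 < t. Proof. exact: dvdn_gt0 tn. Qed.

Definition dihedral_sub : {set gT} := <<[set a ^+ t; a ^+ s * b]>>%g.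

Let H := dihedral_sub.

Let HE : (H = <[a ^+ t]> :|: <[a ^+ t]> :* (a ^+ s * b))%g.
Proof.
rewrite /H /dihedral_sub gen_invol ?reflection2 //.
rewrite conjXg -expgVn; congr (_ ^+ t)%g.
by rewrite conjgM (conjgE a) -expgS expgSr mulKg.
Qed.

Let order_rotX : #[a ^+ t]%g = n %/ t.
Proof. by rewrite orderXdiv order_rotation. Qed.

Let disjoint_H : [disjoint <[a ^+ t]>%g & (<[a ^+ t]> :* (a ^+ s * b))%g].
Proof.
apply/pred0P=> y /=; apply/negP => /andP[/cycleP[i ->]].
case/rcosetP=> _ /cycleP[j ->] /eqP.
by rewrite -!expgM mulgA -expgD rotation_neq_reflection.
Qed.

Lemma big_dihedral_sub (F : gT -> nat) :
  \sum_(y in H) F y = \sum_(k < n %/ t) F (a ^+ (t * k))%g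
                    + \sum_(k < n %/ t) F (a ^+ (s + t * k) * b)%g.
Proof.
under eq_bigl => y do rewrite HE inE.
rewrite bigU ?disjoint_H //=; congr (_ + _).
  rewrite -order_rotX; apply: etrans (big_cycle _ _) _.
  by apply: eq_bigr => k _; rewrite expgM.
rewrite (reindex_inj (mulIg (a ^+ s * b)%g)) /=.
under eq_bigl => y do rewrite mem_rcoset mulgK.
rewrite -order_rotX; apply: etrans (big_cycle _ _) _.
by apply: eq_bigr => k _; rewrite -expgM mulgA -expgD addnC.
Qed.

Lemma card_dihedral_sub : #|H| = 2 * (n %/ t).
Proof.
by rewrite -sum1_card big_dihedral_sub !sum_nat_const card_ord; lia.
Qed.

Lemma dihedral_sub_subset : H \subset G.
Proof.
rewrite gen_subG; apply/subsetP=> y /set2P[]->; first exact: rotation_in.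
exact: reflection_in.
Qed.

Lemma rotation_in_sub k : (a ^+ k \in H)%g = (t %| k).
Proof.
rewrite HE inE; apply/orP/idP => [[/cycleP[j]|/rcosetP[_ /cycleP[j ->]]] /eqP|].
- rewrite -expgM eq_rotation => /eqP/(congr1 (modn^~ t)).
  by rewrite !modn_dvdm // => kE; rewrite /dvdn kE modnMr.
- by rewrite -expgM mulgA -expgD rotation_neq_reflection.
- by case/dvdnP=> j ->; left; rewrite mulnC expgM mem_cycle.
Qed.

Lemma dihedral_coset_rep x : x \in G ->
  exists2 i, i < t & exists2 h, h \in H & x = (a ^+ i * h)%g.
Proof.
have KH k : (a ^+ (t * k) \in H)%g by rewrite rotation_in_sub dvdn_mulr.
have cH : (a ^+ s * b \in H)%g by rewrite mem_gen // set22.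
have rot_rep k :
    exists2 i, i < t & exists2 h, h \in H & (a ^+ k = a ^+ i * h)%g.
  exists (k %% t); first by rewrite ltn_mod.
  exists (a ^+ (t * (k %/ t)))%g => //.
  by rewrite -expgD addnC mulnC -divn_eq.
case/dihedral_eltP=> k [-> | xE]; first exact: rot_rep.
(* The exponent is k - s mod n, written without truncated subtraction: a^k b = a^(k - s) (a^s b). *)
have [i lt_it [h Hh ahE]] := rot_rep (k + (n * s - s)).
exists i => //; exists (h * (a ^+ s * b))%g.
  exact: (@groupM _ <<_>>%G).
rewrite xE mulgA -ahE mulgA -expgD; congr (_ * b)%g.
apply/eqP; rewrite eq_rotation -addnA subnK ?leq_pmull //.
by rewrite addnC mulnC modnMDl.
Qed.

Lemma card_nbr_rotation (S : {set gT}) i :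
  #|[set y in H | CayS S (a ^+ i)%g y]| =
    \sum_(k < n %/ t) (((a ^+ (i + t * k))%g \in S) : nat)
    + \sum_(k < n %/ t) (((a ^+ (i + s + t * k) * b)%g \in S) : nat).
Proof.
rewrite -sum1dep_card big_mkcondr /= big_dihedral_sub.
by congr (_ + _); apply: eq_bigr => k _;
  rewrite /CayS ?mulgA -expgD ?addnA; case: (_ \in S).
Qed.

Let HM x y : x \in H -> y \in H -> (x * y)%g \in H.
Proof. exact: (@groupM _ <<_>>%G). Qed.

Let HV x : x \in H -> (x^-1)%g \in H.
Proof. by move=> Hx; rewrite (@groupV _ <<_>>%G). Qed.

(** Left multiplication by h permutes H and carries neighbours of xh to neighbours of x, so only the
    coset xH matters. *)
Lemma card_nbr_coset (S : {set gT}) x h : h \in H ->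
  #|[set y in H | CayS S (x * h)%g y]| = #|[set y in H | CayS S x y]|.
Proof.
move=> Hh; rewrite -(card_imset _ (mulgI h)); apply: eq_card => y.
rewrite inE; apply/imsetP/andP => [[z] | [Hy Sxy]].
  rewrite inE => /andP[Hz Sz] ->; split; first exact: HM.
  by rewrite /CayS mulgA.
exists (h^-1 * y)%g; last by rewrite mulKVg.
rewrite inE /CayS -mulgA mulKVg; apply/andP; split=> //.
exact: HM (HV Hh) Hy.
Qed.

(** * Normal square-free subsets as patterns *)

Hypothesis n_even : ~~ odd n.

(** Conjugation by b inverts rotations, conjugation by a makes reflections depend on parity only,
    and square-freeness removes even rotations. *)
Lemma normal_square_free_pattern S :
    normal_subset G S -> square_free G S ->
  rotation_pattern n (fun k => (a ^+ k)%g \in S)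
  /\ exists q : pred bool, forall k, ((a ^+ k * b)%g \in S) = q (odd k).
Proof.
move=> [_ nSG] sfS.
have SJ x y : y \in G -> ((x ^ y)%g \in S) = (x \in S).
  by move=> Gy; rewrite -{1}(nSG y Gy) memJ_conjg.
have aG : a \in G by rewrite -genG mem_gen // set21.
have bG : b \in G by rewrite -genG mem_gen // set22.
split; first split=> k.
- by rewrite -order_rotation expg_mod_order.
- by move=> le_kn; rewrite -rotationV // -(conjX_invol ab) SJ.
- move=> ev_k; apply/negP => /sfS; apply; apply/rotation_squareP.
  by exists k./2; rewrite mul2n even_halfK.
exists (fun e => (a ^+ (e : nat) * b)%g \in S) => k.
have S2 i : ((a ^+ i.+2 * b)%g \in S) = ((a ^+ i * b)%g \in S).
  by rewrite -(SJ _ _ aG) reflectionJ_rotation.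
rewrite -{1}[k]odd_double_half; elim: k./2 => [|j IHj]; first by rewrite addn0.
by rewrite doubleS !addnS S2.
Qed.

(** As n is even, the parity of an exponent is well defined mod n, so [q] does define a set of
    reflections. Normality is checked on the generators a and b. *)
Lemma pattern_normal_square_free (P : pred nat) (q : pred bool) :
    rotation_pattern n P ->
  exists S : {set gT}, [/\ normal_subset G S, square_free G S,
    forall k, ((a ^+ k)%g \in S) = P k
    & forall k, ((a ^+ k * b)%g \in S) = q (odd k)].
Proof.
case=> Pmod PN Peven.
pose S := [set (a ^+ k)%g | k : 'I_n & P k]
          :|: [set (a ^+ k * b)%g | k : 'I_n & q (odd k)].
have Srot k : ((a ^+ k)%g \in S) = P k.
  rewrite inE; apply/orP/idP => [[] /imsetP[i]|Pk].
  - rewrite inE -(Pmod k) -(Pmod i) => Pi /eqP.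
    by rewrite eq_rotation => /eqP->.
  - by move=> _ /eqP; rewrite rotation_neq_reflection.
  - left; apply/imsetP; exists (Ordinal (ltn_pmod k n_gt0)).
      by rewrite inE /= Pmod.
    by apply/eqP; rewrite eq_rotation /= modn_mod.
have Srefl k : ((a ^+ k * b)%g \in S) = q (odd k).
  rewrite inE; apply/orP/idP => [[] /imsetP[i]|qk].
  - by move=> _ /esym/eqP; rewrite rotation_neq_reflection.
  - rewrite inE => qi /mulIg/eqP; rewrite eq_rotation => /eqP kiE.
    by rewrite -(odd_mod k (negbTE n_even)) kiE odd_mod // (negbTE n_even).
  - right; apply/imsetP; exists (Ordinal (ltn_pmod k n_gt0)).
      by rewrite inE /= odd_mod // (negbTE n_even).
    by congr (_ * b)%g; apply/eqP; rewrite eq_rotation /= modn_mod.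
have sSG : S \subset G.
  apply/subsetP=> x /setUP[] /imsetP[k _ ->]; first exact: rotation_in.
  exact: reflection_in.
have aV k : (a ^- k = a ^+ (n - k %% n))%g.
  rewrite -rotationV; last by rewrite ltnW ?ltn_pmod.
  by congr (_^-1)%g; apply/eqP; rewrite eq_rotation modn_mod.
have nSa : a \in 'N(S)%g.
  rewrite inE; apply/subsetP=> _ /imsetP[x Sx ->].
  have [k xE] := dihedral_eltP (subsetP sSG x Sx); case: xE Sx => ->.
    by rewrite conjgE -expgSr expgS mulKg.
  (* Adding 2n keeps the element and makes room to subtract the 2 that conjugation by a absorbs. *)
  have -> : (a ^+ k = a ^+ (k + n * 2 - 2).+2)%g.
    apply/eqP; rewrite eq_rotation -addn2 subnK; last by lia.
    by rewrite addnC mulnC modnMDl.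
  by rewrite reflectionJ_rotation !Srefl /= negbK.
have nSb : b \in 'N(S)%g.
  rewrite inE; apply/subsetP=> _ /imsetP[x Sx ->].
  have [k xE] := dihedral_eltP (subsetP sSG x Sx); case: xE Sx => ->.
    by rewrite (conjX_invol ab) aV !Srot PN ?Pmod // ltnW ?ltn_pmod.
  rewrite reflectionJ_reflection aV !Srefl oddB; last by rewrite ltnW ?ltn_pmod.
  by rewrite odd_mod (negbTE n_even).
exists S; split=> //.
- split=> //; apply/normsP.
  by rewrite -genG gen_subG; apply/subsetP=> x /set2P[]->.
- move=> x Sx /rotation_squareP[k xE]; move: Sx.
  by rewrite xE Srot Peven // mul2n odd_double.
Qed.

Lemma regular_dihedral_subP alpha beta :
  regular_set G H alpha beta <-> realizable_counts n t s alpha beta.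
Proof.
have countE (S : {set gT}) (P : pred nat) (q : pred bool) i :
    (forall k, ((a ^+ k)%g \in S) = P k) ->
    (forall k, ((a ^+ k * b)%g \in S) = q (odd k)) ->
  #|[set y in H | CayS S (a ^+ i)%g y]| = coset_count n t s P q i.
  move=> SP Sq; rewrite card_nbr_rotation.
  by congr (_ + _); apply: eq_bigr => k _; rewrite ?SP ?Sq.
have H1 : 1%g \in H by rewrite -(expg0 a) rotation_in_sub dvdn0.
split=> [[S [nS sfS [_ regI regO]]] | [P [q [ratP cntI cntO]]]].
  have [ratP [q Sq]] := normal_square_free_pattern nS sfS.
  exists (fun k => (a ^+ k)%g \in S), q; split=> // [|i /andP[i_gt0 lt_it]].
    by rewrite -(@countE S) // expg0 regI.
  rewrite -(@countE S) // regO // inE rotation_in andbT rotation_in_sub.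
  by rewrite gtnNdvd.
have [S [nS sfS SP Sq]] := pattern_normal_square_free q ratP.
exists S; split=> //; split=> [|x Hx|x]; first exact: dihedral_sub_subset.
  by rewrite -(mul1g x) card_nbr_coset // -(expg0 a) (countE _ P q).
rewrite inE => /andP[H'x Gx]; have [i lt_it [h Hh xE]] := dihedral_coset_rep Gx.
rewrite xE card_nbr_coset // (countE _ P q) // cntO // lt_it andbT lt0n.
by apply: contra H'x => /eqP i0; rewrite xE i0 mul1g.
Qed.

End Dihedral.

(** * Matching the realizable counts with the five cases *)

Theorem theorem3p6 (gT : finGroupType) (G : {group gT}) (a b : gT)
    (n m t s alpha beta : nat)
    (hn : n = 2 * m) (hn4 : 4 <= n)
    (ht1 : 1 < t) (htn : t %| n) (htproper : t < n)
    (hs : s <= t - 1)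
    (hG : (G \isog 'D_(2 * n))%g)
    (hab : (<<[set a; b]>> = G :> {set gT})%g)
    (han : (a ^+ n = 1)%g) (hb2 : (b ^+ 2 = 1)%g)
    (hab_conj : (b^-1 * a * b = a^-1)%g)
    (hnz : (alpha, beta) <> (0, 0)) :
  let H : {set gT} := (<<[set a ^+ t; a ^+ s * b]>>)%g in
  regular_set G H alpha beta <->
  [/\ t = 2, odd m, alpha = 0 \/ alpha = #|H| %/ 2 & 0 <= beta <= #|H|] \/
  [/\ t = 2, ~~ odd m, alpha = 0 \/ alpha = #|H| %/ 2
    & exists gamma : nat, beta = 2 * gamma /\ 0 <= beta <= #|H|] \/
  [/\ 2 < t, ~~ odd t & (alpha, beta) = (#|H| %/ 2, #|H| %/ 2)] \/
  [/\ odd m, t %| m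
    & exists eta zeta : nat,
      [/\ 0 <= eta <= m %/ t, 0 <= zeta <= m %/ t
        & [\/ (alpha, beta) = (eta, zeta),
              (alpha, beta) = (eta + m %/ t, zeta + m %/ t)
            | (alpha, beta) = (eta + (2 * m) %/ t, zeta + (2 * m) %/ t)]]] \/
  [/\ ~~ odd m, odd t
    & exists eta zeta : nat,
      [/\ 0 <= eta <= m %/ (2 * t), 0 <= zeta <= m %/ t
        & [\/ (alpha, beta) = (2 * eta, zeta),
              (alpha, beta) = (2 * eta + m %/ t, zeta + m %/ t)
            | (alpha, beta) = (2 * eta + (2 * m) %/ t,
                               zeta + (2 * m) %/ t)]]].
Proof.
move=> H.
have m_gt0 : 0 < m by lia.
have n_gt0 : 0 < n by lia.
have t_gt0 : 0 < t by lia.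
have n_even : ~~ odd n by rewrite hn oddM.
have oG : #|G| = 2 * n by rewrite (card_isog hG) mul2n card_dihedral; lia.
have ab : (a ^ b = a^-1)%g by rewrite conjgE mulgA.
have := regular_dihedral_subP n_gt0 oG hab han hb2 ab s htn n_even alpha beta.
have := card_dihedral_sub n_gt0 oG hab han hb2 ab s htn.
rewrite /dihedral_sub -/H => oH ->; rewrite oH mulKn // {H oH}.
subst n.
(* Even t gives (1)-(3), and cannot divide an odd m as (4) asks; odd t gives (4) and (5). *)
case: (boolP (odd t)) => odd_t; last first.
  have ntm : odd m -> ~~ (t %| m).
    by move=> odd_m; apply: contra odd_t => t_m; rewrite (dvdn_odd t_m).
  have [t2 | t_neq2] := eqVneq t 2.
    subst t; rewrite mulKn // (realizable_counts_two _ _ _ m_gt0).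
    split=> [[alphaE le_beta mb] | ].
      case: (boolP (odd m)) mb => [odd_m _ | ev_m /= ev_b]; first by left.
      by right; left; split=> //; exists beta./2; split=> //; lia.
    case=> [[_ odd_m alphaE le_beta]|]; first by rewrite odd_m.
    case=> [[_ _ alphaE [gamma [-> le_beta]]]|]; first by rewrite oddM orbT.
    case=> [[]//|]; case=> [[odd_m t_m _]|[]//].
    by move: (ntm odd_m); rewrite t_m.
  have t_gt2 : 2 < t by lia.
  rewrite (realizable_counts_even _ _ _ _ t_gt2 odd_t).
  (* The pair (0, 0) is ruled out by [hnz]. *)
  split=> [[//|abE] | ]; first by right; right; left.
  case=> [[t2]|]; first by case/eqP: t_neq2.
  case=> [[t2]|]; first by case/eqP: t_neq2.
  case=> [[_ _ abE]|]; first by right.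
  by case=> [[odd_m t_m _]|[_ odd_t2]];
    [move: (ntm odd_m); rewrite t_m | case/negP: odd_t].
have tm : t %| m by rewrite -(@Gauss_dvdr _ 2) // coprimen2.
rewrite (realizable_counts_odd _ _ _ m_gt0 ht1 odd_t tm) -muln_divA //.
(* The bound on eta is half of m/t rounded down, so it says that x = 2 eta is at most m/t. *)
have hE : m %/ (2 * t) = (m %/ t)./2 by rewrite mulnC divnMA divn2.
split=> [[e [x [y [le_e le_x le_y odd_mx abE]]]] | ].
  do 3!right; case: (boolP (odd m)) odd_mx => [odd_m _ | ev_m /= ev_x].
    left; split=> //; exists x, y; split=> //.
    (* The values 0, 1, 2 of [e] select the three families in order. *)
    by case: e le_e abE => [|[|[|//]]] _ ->;
      [constructor 1 | constructor 2 | constructor 3];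
      rewrite ?muln0 ?muln1 ?addn0 // [m %/ t * 2]mulnC.
  right; split=> //; exists x./2, y; rewrite hE mul2n even_halfK //.
  split; [by lia | by [] |].
  by case: e le_e abE => [|[|[|//]]] _ ->;
    [constructor 1 | constructor 2 | constructor 3];
    rewrite ?muln0 ?muln1 ?addn0 // [m %/ t * 2]mulnC.
case=> [[t2]|]; first by rewrite t2 in odd_t.
case=> [[t2]|]; first by rewrite t2 in odd_t.
case=> [[_ /negP//]|].
case=> [[odd_m _ [eta [zeta [le_eta le_zeta abE]]]]|].
  rewrite odd_m; case: abE => ->; [exists 0 | exists 1 | exists 2];
  by exists eta, zeta; rewrite ?muln0 ?muln1 ?addn0 // [m %/ t * 2]mulnC.
case=> ev_m _ [eta [zeta [le_eta le_zeta abE]]].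
have le_2eta : 2 * eta <= m %/ t by rewrite hE in le_eta; lia.
case: abE => ->; [exists 0 | exists 1 | exists 2];
  by exists (2 * eta), zeta; rewrite oddM orbT; split=> //;
    rewrite ?muln0 ?muln1 ?addn0 // [m %/ t * 2]mulnC.
Qed.
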